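(* Let $X=\lambda_p(A,\mathbb{Z})$ be a Köthe sequence space, where $A=(a_{j,k})_{j\in\mathbb{Z},k\in\mathbb{N}}$ is a Köthe matrix on $\mathbb{Z}$ and $p\in\{0\}\cup[1,\infty)$. Let $w=(w_j)_{j\in\mathbb{Z}}$ be a sequence of nonzero scalars such that the bilateral weighted backward shift $$B_w:(x_j)_{j\in\mathbb{Z}}\in X\mapsto (w_{j+1}x_{j+1})_{j\in\mathbb{Z}}\in X$$ is an invertible operator on $X$. Then $B_w$ is average expansive if and only if there exists $k\in\mathbb{N}$ such that $$\sup_{n\in\mathbb{N}}\Big(\frac1n\sum_{j=1}^n a_{-j,k}\,|w_{-j+1}\cdots w_0|\Big)=\infty\quad\text{or}\quad \sup_{n\in\mathbb{N}}\Big(\frac1n\sum_{j=1}^n\frac{a_{j,k}}{|w_1\cdots w_j|}\Big)=\infty.$$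
   Context: $\mathbb{K}$ denotes $\mathbb{R}$ or $\mathbb{C}$, and $\mathbb{N}=\{1,2,3,\dots\}$. An operator on a locally convex space $X$ is a continuous linear map $X\to X$; it is invertible if it has a continuous inverse, and $GL(X)$ is the set of invertible operators. A Köthe matrix on $\mathbb{Z}$ is a family of scalars $A=(a_{j,k})_{j\in\mathbb{Z},k\in\mathbb{N}}$ such that for each $j\in\mathbb{Z}$: $0\le a_{j,1}\le a_{j,2}\le\cdots$, and $a_{j,k}>0$ for some $k$. For $p\in[1,\infty)$, $\lambda_p(A,\mathbb{Z})=\{(x_j)\in\mathbb{K}^{\mathbb{Z}}:\sum_{j\in\mathbb{Z}}|a_{j,k}x_j|^p<\infty\text{ for all }k\in\mathbb{N}\}$ with seminorms $\|x\|_k=(\sum_{j\in\mathbb{Z}}|a_{j,k}x_j|^p)^{1/p}$, $k\in\mathbb{N}$. For $p=0$, $\lambda_0(A,\mathbb{Z})=\{(x_j)\in\mathbb{K}^{\mathbb{Z}}:\lim_{|j|\to\infty}a_{j,k}x_j=0\text{ for all }k\in\mathbb{N}\}$ with seminorms $\|x\|_k=\sup_{j\in\mathbb{Z}}|a_{j,k}x_j|$, $k\in\mathbb{N}$. These are Fréchet spaces with the topology induced by these seminorms. Known fact (convention $0/0=1$): $B_w$ is an operator on $\lambda_p(A,\mathbb{Z})$ iff for each $k$ there is $\ell$ such that $a_{j,k}=0$ whenever $a_{j+1,\ell}=0$, and $\sup_{j}\frac{a_{j,k}|w_{j+1}|}{a_{j+1,\ell}}<\infty$; in this case it is invertible iff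 for each $k$ there is $\ell$ such that $a_{j+1,k}=0$ whenever $a_{j,\ell}=0$, and $\sup_j\frac{a_{j+1,k}}{a_{j,\ell}|w_{j+1}|}<\infty$. Average expansivity: if the topology of $X$ is induced by a family $(\|\cdot\|_\alpha)_{\alpha\in I}$ of seminorms, $T\in GL(X)$ is average expansive if for each $x\in X\setminus\{0\}$ there exists $\alpha\in I$ such that $\sup_{n\in\mathbb{N}}\big(\frac{1}{2n+1}\sum_{j=-n}^{n}\|T^jx\|_\alpha\big)=\infty$. (This does not depend on the choice of the family; here one may use $(\|\cdot\|_k)_{k\in\mathbb{N}}$.) *)

(* Defs.v *)
(* MathComp / MathComp-Analysis *)
From HB Require Import structures.
From mathcomp Require Import all_boot all_order all_algebra.
From mathcomp Require Import all_classical all_reals all_analysis.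
From mathcomp Require Import complex.

Set Implicit Arguments.
Unset Strict Implicit.
Unset Printing Implicit Defensive.

Import Order.TTheory GRing.Theory Num.Theory.

Local Open Scope classical_set_scope.
Local Open Scope ring_scope.

Variant scalar_kind := RealScalars | ComplexScalars.

Definition scalar_field (R : realType) (s : scalar_kind) : numFieldType :=
  match s with
  | RealScalars => R
  | ComplexScalars => R[i]
  end.

Definition modulus (R : realType) (s : scalar_kind) : scalar_field R s -> R :=
  match s with
  | RealScalars => fun x : R => `|x|
  | ComplexScalars => @ComplexField.Normc.normc R
  end.

Section modulus_theory.
Context {R : realType} {s : scalar_kind}.
Implicit Types x y : scalar_field R s.

Lemma modulus_ge0 x : 0 <= modulus x.
Proof. by case: s x => [x|[a b]] /=; rewrite ?normr_ge0 ?sqrtr_ge0. Qed.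

Lemma modulus0 : modulus (0 : scalar_field R s) = 0.
Proof. by case: s; [exact: normr0|exact: ComplexField.Normc.normc0]. Qed.

Lemma modulusM x y : modulus (x * y) = modulus x * modulus y.
Proof.
by case: s x y => x y; [exact: normrM|exact: ComplexField.Normc.normcM].
Qed.

Lemma modulusD x y : modulus (x + y) <= modulus x + modulus y.
Proof. by case: s x y => x y; [exact: ler_normD|exact: le_normcD]. Qed.

End modulus_theory.

(* Topology induced on V by a family q of seminorms: U is open when every x in
   U has a ball {y | q i (y - x) < e, i in t}, with t finite and e > 0,
   contained in U. *)
Definition seminorm_topology (R : realType) (K : numFieldType)
  (V : lmodType K) (I : Type) (q : I -> V -> R) : Type := V.

Section seminorm_topology.
Context {R : realType} {K : numFieldType} {V : lmodType K} {I : choiceType}.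
Variable q : I -> V -> R.

Definition seminorm_ball (x : V) (t : seq I) (e : R) : set V :=
  [set y | forall i, i \in t -> q i (y - x) < e].

Definition seminorm_open (U : set V) : Prop :=
  forall x, U x -> exists t : seq I, exists2 e : R, 0 < e &
    seminorm_ball x t e `<=` U.

Local Lemma seminorm_openT : seminorm_open setT.
Proof. by move=> x _; exists [::]; exists 1. Qed.

Local Lemma seminorm_openI : setI_closed seminorm_open.
Proof.
move=> U W oU oW x [/oU[t [e e0 eU]] /oW[u [d d0 dW]]].
exists (t ++ u); exists (Num.min e d); first by rewrite lt_min e0 d0.
move=> y xy; split.
- apply: eU => i it; apply: (lt_le_trans (xy i _)).
    by rewrite mem_cat it.
  by rewrite ge_min lexx.
- apply: dW => i iu; apply: (lt_le_trans (xy i _)).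
    by rewrite mem_cat iu orbT.
  by rewrite ge_min lexx orbT.
Qed.

Local Lemma seminorm_open_bigU (J : Type) (U : J -> set V) :
  (forall j, seminorm_open (U j)) -> seminorm_open (\bigcup_j U j).
Proof.
move=> oU x [j _ /oU[t [e e0 eU]]]; exists t; exists e => // y xy.
by exists j => //; exact: eU.
Qed.

HB.instance Definition _ := Choice.copy (seminorm_topology q) V.
HB.instance Definition _ := isOpenTopological.Build (seminorm_topology q)
  seminorm_openT seminorm_openI seminorm_open_bigU.

End seminorm_topology.

Record invertible_operator (K : numFieldType) (X : preTopologicalLmodType K) :=
  InvertibleOperator {
    op :> {linear X -> X};
    op_inv : X -> X;
    op_continuous : continuous op;
    op_inv_continuous : continuous op_inv;
    opK : cancel op op_inv;
    op_invK : cancel op_inv op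
  }.

(* The iterate T^n, n an integer *)
Definition op_iter (K : numFieldType) (X : preTopologicalLmodType K)
  (T : invertible_operator X) (n : int) : X -> X :=
  match n with
  | Posz m => iter m T
  | Negz m => iter m.+1 (op_inv T)
  end.

(* q is meant to be a family of seminorms inducing the topology of X, the
   notion being independent of the choice of this family. The sum runs over
   -n <= j <= n, reindexed by j = i - n. *)
Definition average_expansive (R : realType) (K : numFieldType)
  (X : preTopologicalLmodType K) (I : Type) (q : I -> X -> R)
  (T : invertible_operator X) : Prop :=
  forall x : X, x != 0 -> exists a : I,
    ereal_sup [set (((2 * n + 1)%:R)^-1 *
        \sum_(i < 2 * n + 1) q a (op_iter T (i%:Z - n%:Z) x))%:E
      | n in [set n : nat | (0 < n)%N]] = +oo%E.

(* The index k of a_{j,k} starts at 0 instead of 1. *)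
Record kothe_matrix (R : realType) := KotheMatrix {
  kothe_entry :> int -> nat -> R;
  kothe_entry_ge0 : forall j, 0 <= kothe_entry j 0;
  kothe_entry_le : forall j k, kothe_entry j k <= kothe_entry j k.+1;
  kothe_entry_gt0 : forall j, exists k, 0 < kothe_entry j k
}.

Section kothe_space.
Context {R : realType} (s : scalar_kind) (A : kothe_matrix R) (p : R).

Local Notation K := (scalar_field R s).

Let term (k : nat) (x : int -> K^o) (j : int) : R := A j k * modulus (x j).

(* Only p = 0 and p >= 1 are meaningful: the case p = 0 is the second branch
   here and in kothe_seminorm. *)
Definition kothe_seq : {pred int -> K^o} := fun x =>
  `[< if 1 <= p then
        forall k, (\esum_(j in [set: int]) (term k x j `^ p)%:E < +oo)%E
      else
        forall k (e : R), 0 < e ->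
          exists N : nat, forall j : int, (N <= `|j|)%N -> term k x j < e >].

Record kothe := Kothe {
  kothe_fun :> int -> K^o;
  kotheP : kothe_fun \in kothe_seq
}.

HB.instance Definition _ := [isSub for kothe_fun].
HB.instance Definition _ := [Choice of kothe by <:].

Lemma kothe_entry_nonneg j k : 0 <= A j k.
Proof.
elim: k => [|k IH]; first exact: kothe_entry_ge0.
exact: le_trans IH (kothe_entry_le _ _ _).
Qed.

Let term_ge0 k x j : 0 <= term k x j.
Proof. by rewrite mulr_ge0 ?modulus_ge0 ?kothe_entry_nonneg. Qed.

Let term0 k j : term k 0 j = 0.
Proof. by rewrite /term [(0 : int -> K^o) j]/(0 : K) modulus0 mulr0. Qed.

Let termD c x y k j :
  term k (c *: x + y) j <= modulus c * term k x j + term k y j.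
Proof.
rewrite /term [(c *: x + y) j]/(c * x j + y j : K).
rewrite mulrCA -mulrDr ler_wpM2l ?kothe_entry_nonneg//.
by rewrite -modulusM modulusD.
Qed.

Let esum_natmul (f : int -> R) n : (forall j, 0 <= f j) ->
  (\esum_(j in [set: int]) (f j)%:E < +oo ->
   \esum_(j in [set: int]) (f j *+ n)%:E < +oo)%E.
Proof.
move=> f0 foo; elim: n => [|n IH]; first by rewrite esum1.
under eq_esum do rewrite mulrSr EFinD.
rewrite esumD; first exact: lte_add_pinfty.
- by move=> j _; rewrite lee_fin mulrn_wge0.
- by move=> j _; rewrite lee_fin.
Qed.

Lemma kothe_submod_closed : submod_closed kothe_seq.
Proof.
rewrite /kothe_seq; split; first (rewrite unfold_in; apply/asboolP; case: ifPn).
- move=> p1 k; rewrite esum1// => j _.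
  by rewrite term0 powR0// gt_eqF// (lt_le_trans _ p1).
- by move=> _ k e e0; exists 0%N => j _; rewrite term0.
move=> c x y; rewrite !unfold_in => /asboolP xK /asboolP yK; apply/asboolP.
case: ifPn xK yK => [p1|_] xK yK k; last first.
  move=> e e0; pose M := modulus c + 1.
  have M0 : 0 < M by rewrite ltr_wpDl ?modulus_ge0.
  have e2 : 0 < e / 2 by rewrite divr_gt0.
  have [N1 xN] := xK k (e / 2 / M) (divr_gt0 e2 M0).
  have [N2 yN] := yK k (e / 2) e2.
  exists (maxn N1 N2) => j; rewrite geq_max => /andP[/xN xj /yN yj].
  apply: (le_lt_trans (termD _ _ _ _ _)); rewrite [e]splitr ler_ltD//.
  rewrite ltr_pdivlMr// in xj; rewrite ltW// (le_lt_trans _ xj)// mulrC.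
  by rewrite ler_wpM2l// lerDl.
have p0 : 0 <= p by rewrite (le_trans _ p1).
have [n cn] : exists n : nat, (2 * (modulus c + 1)) `^ p <= n%:R.
  by exists (Num.truncn ((2 * (modulus c + 1)) `^ p)).+1; exact/ltW/truncnS_gt.
apply: (@le_lt_trans _ _
  (\esum_(j in [set: int]) ((term k x j `^ p + term k y j `^ p) *+ n)%:E)%E).
  apply: le_esum => j _; rewrite lee_fin.
  set a := term k x j; set b := term k y j.
  have a0 : 0 <= a by exact: term_ge0.
  have b0 : 0 <= b by exact: term_ge0.
  have c0 := modulus_ge0 c.
  pose m := Num.max a b.
  have am : a <= m by rewrite le_max lexx.
  have bm : b <= m by rewrite le_max lexx orbT.
  have m0 : 0 <= m := le_trans a0 am.
  have c1m : 0 <= 2 * (modulus c + 1) by rewrite mulr_ge0// addr_ge0.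
  have le1 : term k (c *: x + y) j <= 2 * (modulus c + 1) * m.
    apply: (le_trans (termD _ _ _ _ _)).
    rewrite -/a -/b mulrDr mulr1 mulrDl lerD//.
      rewrite ler_pM//.
      by rewrite mulr_natl mulr2n lerDl.
    by rewrite mulr_natl mulr2n (le_trans bm)// lerDl.
  apply: (@le_trans _ _ ((2 * (modulus c + 1) * m) `^ p)).
    by apply: ge0_ler_powR; rewrite ?nnegrE// mulr_ge0.
  rewrite powRM// -[leRHS]mulr_natl.
  apply: ler_pM => //; rewrite ?powR_ge0// /m.
  by case: (leP a b) => _; rewrite ?lerDl ?lerDr powR_ge0.
apply: esum_natmul => [j|]; first by rewrite addr_ge0 ?powR_ge0.
under eq_esum do rewrite EFinD.
rewrite esumD; first by apply: lte_add_pinfty; [exact: xK|exact: yK].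
- by move=> j _; rewrite lee_fin powR_ge0.
- by move=> j _; rewrite lee_fin powR_ge0.
Qed.

HB.instance Definition _ :=
  GRing.isSubmodClosed.Build _ _ kothe_seq kothe_submod_closed.
HB.instance Definition _ := [SubChoice_isSubLmodule of kothe by <:].

Definition kothe_seminorm (k : nat) (x : kothe) : R :=
  if 1 <= p then
    fine (\esum_(j in [set: int]) (term k x j `^ p)%:E) `^ p^-1
  else sup (range (term k x)).

HB.instance Definition _ :=
  Topological.copy kothe (seminorm_topology kothe_seminorm).

End kothe_space.

(* The sequence B_w x *)
Definition weighted_shift (K : numFieldType) (w x : int -> K) : int -> K :=
  fun j => w (j + 1) * x (j + 1).

(* Main.v *)
Require Import Defs.
From mathcomp Require Import all_boot all_order all_algebra.
From mathcomp Require Import all_classical all_reals all_analysis.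
From mathcomp Require Import complex zify ring lra.

Import Order.TTheory GRing.Theory Num.Theory.

Local Open Scope classical_set_scope.
Local Open Scope ring_scope.

(** Let v be the cumulative weight, the sequence with v_0 = 1 and
    v_{j+1} = w_{j+1} v_j for every integer j. Multiplying coordinatewise by v
    turns the weighted shift into the plain translation:
      v_j (B_w^n x)_j = v_{j+n} x_{j+n}   for every integer n
    (op_iter_transport). Put g_k(j) = a_{j,k} / |v_j|, the function growth. The
    averages of g_k over {-n, ..., -1} and over {1, ..., n} are exactly the two
    averages of the criterion, so B_w has to be shown average expansive iff one
    of these is unbounded in n for some k.

    If B_w is average expansive, apply this to the unit vector e_0. Since
    B_w^n e_0 is supported at the single point -n, its k-th seminorm is
    g_k(-n), and the symmetric averages of the orbit are controlled by g_k(0)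
    and the two one-sided averages of g_k (sum_window); these cannot both be
    bounded.

    Conversely let x be nonzero, say x_m <> 0. A seminorm dominates each of its
    coordinate terms, so looking at coordinate m - n of B_w^n x gives
      ||B_w^n x||_k >= |v_m x_m| g_k(m - n)   (growth_le_orbit).
    Averages of g_k over windows centred at m are unbounded as soon as one of
    the one-sided averages is: the window of radius n + |m| around m contains
    {-n, ..., n}, and its length is at most (2|m| + 3) n
    (unbounded_window_average). The same k thus works for all x.

    The cases p = 0 and p >= 1 meet in the two estimates on seminorms used above,
    coord_le_kothe_seminorm and kothe_seminorm_supported. *)

(** * Averages of functions on the integers *)

Section averages.
Context {R : realType}.
Implicit Types (u : nat -> R) (f : int -> R).

Definition unbounded u := forall M, exists2 n, (0 < n)%N & M < u n.

Lemma not_unbounded u :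
  ~ unbounded u -> exists M, forall n, (0 < n)%N -> u n <= M.
Proof.
move=> uN; apply: contrapT => noM; apply: uN => M.
apply: contrapT => nM; apply: noM; exists M => n n0; rewrite leNgt.
by apply/negP => Mu; apply: nM; exists n.
Qed.

Lemma ereal_sup_pinfty u :
  ereal_sup [set (u n)%:E | n in [set n : nat | (0 < n)%N]] = +oo%E <->
  unbounded u.
Proof.
split=> [supu|uu].
  apply: contrapT => /not_unbounded[M uM].
  suff : (ereal_sup [set (u n)%:E | n in [set n : nat | (0 < n)%N]] <= M%:E)%E.
    by rewrite supu leye_eq.
  by apply: ge_ereal_sup => _ [n /= n0 <-]; rewrite lee_fin uM.
apply/eqyP => M M0; have [n n0 Mu] := uu M.
apply: (@le_trans _ _ (u n)%:E); first by rewrite lee_fin ltW.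
by apply: ereal_sup_ubound; exists n.
Qed.

(** The window runs over -n, ..., n as in the definition of average
    expansivity; splitting it at 0 exposes the two one-sided sums. *)
Lemma sum_window f n :
  \sum_(i < 2 * n + 1) f (i%:Z - n%:Z) =
  f 0 + \sum_(1 <= j < n.+1) f (- j%:Z) + \sum_(1 <= j < n.+1) f j%:Z.
Proof.
elim: n => [|n IH]; first by rewrite !big_geq// muln0 big_ord1 !addr0.
rewrite (_ : (2 * n.+1 + 1)%N = (2 * n + 1).+2); last by lia.
rewrite big_ord_recl big_ord_recr/= !(big_nat_recr n.+1)//=.
have shift (i : nat) : (bump 0 i)%:Z - n.+1%:Z = i%:Z - n%:Z by rewrite /bump; lia.
under eq_bigr do rewrite shift.
rewrite IH (_ : (bump 0 (2 * n + 1))%:Z - n.+1%:Z = n.+1%:Z :> int); last first.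
  by rewrite /bump; lia.
rewrite sub0r; ring.
Qed.

(** The integers of absolute value at most n lie in the window of radius
    n + |m| centred at m, and an injective enumeration g of some of them visits
    each place of that window at most once. *)
Lemma ler_sum_window f m n (g : 'I_n -> int) : (forall j, 0 <= f j) ->
  injective g -> (forall j, (`|g j| <= n)%N) ->
  \sum_(j < n) f (g j) <=
  \sum_(i < 2 * (n + `|m|) + 1) f (m - (i%:Z - (n + `|m|)%N%:Z)).
Proof.
move=> f0 gI gn.
(* g j is the term of the window with index m + (n + |m|) - g j. *)
have hP j : (absz (m + (n + `|m|)%N%:Z - g j)%R < 2 * (n + `|m|) + 1)%N.
  by have := gn j; lia.
pose h j := Ordinal (hP j).
have hE j : m - ((h j)%:Z - (n + `|m|)%N%:Z) = g j.
  by rewrite /=; have := gn j; lia.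
have hI : injective h by move=> i j hij; apply: gI; rewrite -hE -[RHS]hE hij.
under eq_bigr do rewrite -hE.
rewrite -(big_imset (fun i : 'I__ => f (m - (i%:Z - (n + `|m|)%N%:Z))))/=; last first.
  by move=> i j _ _; exact: hI.
rewrite [leRHS](bigID (mem [set h x | x in 'I_n])%SET)/= lerDl.
by apply: sumr_ge0 => i _; exact: f0.
Qed.

(** Passing from {1, ..., n} or {-n, ..., -1} to a window centred at m replaces
    n by n + |m|, hence multiplies the length by at most 2|m| + 3, a constant
    factor that cannot make unbounded averages bounded. Both one-sided
    averages are covered, by g j = j and g j = - j. *)
Lemma unbounded_window_average f m (g : nat -> int) (c : R) :
  (forall j, 0 <= f j) -> 0 < c ->
  injective g -> (forall j, `|g j|%N = j) ->
  unbounded (fun n => n%:R^-1 * \sum_(1 <= j < n.+1) f (g j)) ->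
  unbounded (fun n => (2 * n + 1)%:R^-1 *
    \sum_(i < 2 * n + 1) (c * f (m - (i%:Z - n%:Z)))).
Proof.
move=> f0 c0 gI gE ug M.
(* 2 (n + |m|) + 1 <= D n for every n > 0. *)
pose D : R := (2 * `|m| + 3)%N%:R.
have D0 : 0 < D by rewrite ltr0n addn3.
have [n n0 Mn] := ug (`|M| * D / c).
exists (n + `|m|)%N; first by lia.
rewrite -mulr_sumr.
set S := \sum_(i < _) _.
have n0' : 0 < n%:R :> R by rewrite ltr0n.
have nS : \sum_(1 <= j < n.+1) f (g j) <= S.
  rewrite big_add1/= big_mkord; apply: (@ler_sum_window f m n (fun j => g j.+1)).
  - exact: f0.
  - by move=> i j /gI[] /val_inj.
  - by move=> j; rewrite gE ltn_ord.
have S0 : 0 <= S by rewrite sumr_ge0.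
have W0 : 0 < (2 * (n + `|m|) + 1)%N%:R :> R by rewrite ltr0n addn1.
apply: (le_lt_trans (ler_norm M)).
rewrite mulrC ltr_pdivlMr//.
move: Mn; rewrite ltr_pdivrMr// -mulrA ltr_pdivlMl// => Mn.
apply: (@le_lt_trans _ _ (n%:R * (`|M| * D))).
  rewrite mulrCA ler_wpM2l// /D -natrM ler_nat; nia.
by apply: (lt_le_trans Mn); rewrite mulrC ler_wpM2l// ltW.
Qed.

End averages.

(** * Coordinates and seminorms in Koethe spaces *)

Section modulus_facts.
Context {R : realType} {s : scalar_kind}.
Implicit Types x : scalar_field R s.

Lemma modulus_gt0 x : x != 0 -> 0 < modulus x.
Proof.
move=> x0; rewrite lt_neqAle modulus_ge0 andbT eq_sym.
apply: contra_neq x0; case: s x => x; first exact: normr0_eq0.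
exact: ComplexField.Normc.eq0_normc.
Qed.

Lemma modulus1 : modulus (1 : scalar_field R s) = 1.
Proof. by case: s; [exact: normr1|exact: ComplexField.Normc.normc1]. Qed.

Lemma modulusV x : x != 0 -> modulus x^-1 = (modulus x)^-1.
Proof.
move=> x0; have mx0 := modulus_gt0 _ x0.
apply: (mulfI (lt0r_neq0 mx0)).
by rewrite -modulusM !divff ?modulus1// lt0r_neq0.
Qed.

End modulus_facts.

Lemma esum_supported1 (R : realType) (I : choiceType) (F : I -> \bar R) (m : I) :
  (forall i, i != m -> F i = 0%E) -> (0%R <= F m)%E ->
  (\esum_(i in [set: I]) F i)%E = F m.
Proof.
move=> Fm F0; rewrite -(@esum_set1 _ _ m F F0) [RHS]esum_mkcond.
by apply: eq_esum => i _; case: ifPn => //; rewrite notin_setE/= => /eqP /Fm.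
Qed.

Section kothe_facts.
Context {R : realType} {s : scalar_kind} {A : kothe_matrix R} {p : R}.
Local Notation K := (scalar_field R s).
Local Notation X := (kothe s A p).
Implicit Types x : X.

Lemma kothe_term_ge0 (c : K) j k : 0 <= A j k * modulus c.
Proof. by rewrite mulr_ge0 ?modulus_ge0 ?kothe_entry_nonneg. Qed.

(** For p >= 1 the term is bounded by the whole sum, which is finite because x
    is in the space. For p = 0 the supremum is a genuine upper bound because a
    sequence tending to 0 is bounded. *)
Lemma coord_le_kothe_seminorm x k j :
  A j k * modulus (kothe_fun x j) <= kothe_seminorm k x.
Proof.
have := kotheP x; rewrite unfold_in /kothe_seminorm => /asboolP.
case: ifPn => p1 xX.
  have p0 : 0 < p by exact: lt_le_trans p1.
  set F := fun i => ((A i k * modulus (kothe_fun x i)) `^ p)%:E.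
  have F0 i : (0%R <= F i)%E by rewrite lee_fin powR_ge0.
  have Ffin : (\esum_(i in [set: int]) F i)%E \is a fin_num.
    by rewrite ge0_fin_numE ?esum_ge0//; exact: xX.
  (* Write the term as (term ^ p) ^ (1 / p) to compare p-th powers. *)
  rewrite -[leLHS]powRr1 ?kothe_term_ge0// -[X in _ `^ X](@mulfV _ p) ?gt_eqF//.
  rewrite powRrM ge0_ler_powR ?invr_ge0 ?nnegrE ?powR_ge0 ?(ltW p0)//.
    by apply/fine_ge0/esum_ge0 => i _; exact: F0.
  rewrite -lee_fin fineK//.
  rewrite -[leLHS]/(F j) -(@esum_set1 _ _ j F (F0 j)).
  rewrite [leLHS]esum_mkcond; apply: le_esum => i _.
  by case: ifP => // _; exact: F0.
apply: ub_le_sup; last by exists j.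
have [N xN] := xX k 1 ltr01.
set t := fun i : int => A i k * modulus (kothe_fun x i).
have t0 i : 0 <= t i by exact: kothe_term_ge0.
(* Terms beyond N are below 1; the finitely many others are bounded by their
   sum. *)
exists (1 + \sum_(i < N) (t i%:Z + t (- i%:Z))) => _ [i _ <-].
rewrite -/(t i).
have S0 : 0 <= \sum_(i < N) (t i%:Z + t (- i%:Z)).
  by apply: sumr_ge0 => l _; rewrite addr_ge0.
have [Ni|iN] := leqP N `|i|; first by rewrite (le_trans (ltW (xN _ Ni)))// lerDl.
rewrite (bigD1 (Ordinal iN))//=.
have ti : t i <= t `|i|%:Z + t (- `|i|%:Z).
  have [i0|i0] := leP 0 i; first by rewrite gez0_abs// lerDl.
  by rewrite ltz0_abs// opprK lerDr.
rewrite (le_trans ti)// addrCA lerDl addr_ge0// sumr_ge0// => l _.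
by rewrite addr_ge0.
Qed.

Lemma kothe_seminorm_supported x k m :
  (forall j, j != m -> kothe_fun x j = 0) ->
  kothe_seminorm k x <= A m k * modulus (kothe_fun x m).
Proof.
move=> xm; rewrite /kothe_seminorm; case: ifPn => p1.
  have p0 : 0 < p by exact: lt_le_trans p1.
  rewrite -[leRHS]powRr1 ?kothe_term_ge0// -[X in _ <= _ `^ X](@mulfV _ p) ?gt_eqF//.
  rewrite powRrM.
  set F := fun i => ((A i k * modulus (kothe_fun x i)) `^ p)%:E.
  rewrite (@esum_supported1 _ _ F m)// => [i im|]; last by rewrite lee_fin powR_ge0.
  by rewrite /F xm// modulus0 mulr0 powR0// gt_eqF.
apply: ge_sup; first by exists (A m k * modulus (kothe_fun x m)), m.
move=> _ [j _ <-]; have [->//|jm] := eqVneq j m.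
by rewrite xm// modulus0 mulr0 kothe_term_ge0.
Qed.

Lemma kothe_neq0 x : x != 0 -> exists m, kothe_fun x m != 0.
Proof.
move=> /eqP x0; apply: contrapT => xN; apply: x0; apply: val_inj.
rewrite raddf0; apply/funext => j; apply: contrapT => xj; apply: xN.
by exists j; apply/eqP.
Qed.

Definition unit_seq (j : int) : K^o := if j == 0 then 1 else 0.

Lemma unit_seqP : unit_seq \in kothe_seq A p.
Proof.
rewrite unfold_in; apply/asboolP; case: ifPn => [p1 k|_ k e e0].
  set F := fun i => ((A i k * modulus (unit_seq i)) `^ p)%:E.
  have p0 : 0 < p by exact: lt_le_trans p1.
  rewrite (@esum_supported1 _ _ F 0) ?ltry// => [i im|]; last by rewrite lee_fin powR_ge0.
  by rewrite /F /unit_seq (negbTE im) modulus0 mulr0 powR0// gt_eqF.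
exists 1%N => j; rewrite absz_gt0 => j0.
by rewrite /unit_seq (negbTE j0) modulus0 mulr0.
Qed.

Definition unit_vector : X := Kothe unit_seqP.

Lemma unit_vector_neq0 : unit_vector != 0.
Proof.
apply/eqP => /(congr1 val); rewrite raddf0 => /(congr1 (@^~ 0))/=.
by rewrite /unit_seq eqxx => /eqP; rewrite oner_eq0.
Qed.

End kothe_facts.

(** * Cumulative weights and iterates of the shift *)

Section weights.
Context {K : numFieldType} (w : int -> K).
Context (w_neq0 : forall j, w j != 0).

(** Since Negz m is -(m+1), the second branch is 1 / (w_{-m} ... w_0), as
    forced by the recurrence cumulative_weightS. *)
Definition cumulative_weight (j : int) : K :=
  match j with
  | Posz m => \prod_(1 <= i < m.+1) w i%:Z
  | Negz m => (\prod_(0 <= i < m.+1) w (- i%:Z))^-1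
  end.
Local Notation v := cumulative_weight.

Lemma cumulative_weight_neq0 j : v j != 0.
Proof.
by case: j => m; rewrite ?invr_eq0 prodf_seq_neq0; apply/allP => i _; apply/implyP.
Qed.

Lemma cumulative_weightS j : v (j + 1) = w (j + 1) * v j.
Proof.
case: j => [m|[|m]].
- by rewrite -PoszD addn1 /v big_nat_recr//= mulrC.
- by rewrite /v/= big_geq// big_nat1 oppr0 mulfV.
- have -> : Negz m.+1 + 1 = Negz m by lia.
  rewrite /v [in RHS]big_nat_recr//= invfM.
  by rewrite NegzE mulrCA mulfV ?mulr1.
Qed.

End weights.

(** The k-th seminorm of the image of the unit vector at 0 under the iterate of
    exponent -j of the shift: that image is 1 / v_j times the unit vector at
    j. *)
Definition growth (R : realType) (s : scalar_kind) (A : kothe_matrix R)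
    (w : int -> scalar_field R s) (k : nat) (j : int) : R :=
  A j k / modulus (cumulative_weight w j).
Arguments growth {R s} A w k j.

Section orbits.
Context {R : realType} {s : scalar_kind} {A : kothe_matrix R} {p : R}.
Context {w : int -> scalar_field R s}.
Context {T : invertible_operator (kothe s A p)}.
Context (w_neq0 : forall j, w j != 0).
Context (TE : forall x : kothe s A p,
  kothe_fun (T x) = weighted_shift w (kothe_fun x)).
Local Notation v := (cumulative_weight w).

Lemma shift_transport x j :
  v j * kothe_fun (T x) j = v (j + 1) * kothe_fun x (j + 1).
Proof. by rewrite TE /weighted_shift cumulative_weightS// mulrCA mulrA. Qed.

(** One step of the shift is translation by 1 after multiplication by the
    cumulative weight, so the inverse is translation by -1 and n steps are
    translation by n. *)
Lemma op_iter_transport x n j :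
  v j * kothe_fun (op_iter T n x) j = v (j + n) * kothe_fun x (j + n).
Proof.
case: n => m; rewrite /op_iter.
  elim: m j => [|m IH] j; first by rewrite addr0.
  by rewrite iterS shift_transport IH; congr (v _ * kothe_fun x _); lia.
have inv y i : v i * kothe_fun (op_inv T y) i = v (i - 1) * kothe_fun y (i - 1).
  by rewrite -[in RHS](op_invK T y) shift_transport subrK.
rewrite NegzE; elim: m.+1 j => [|l IH] j; first by rewrite oppr0 addr0.
by rewrite iterS inv IH; congr (v _ * kothe_fun x _); lia.
Qed.

Lemma modulus_op_iter x n j :
  modulus (kothe_fun (op_iter T n x) j) =
  modulus (v (j + n) * kothe_fun x (j + n)) / modulus (v j).
Proof.
have vj0 := cumulative_weight_neq0 _ w_neq0 j.
rewrite -op_iter_transport [in RHS]modulusM mulrAC mulfV ?mul1r//.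
by rewrite lt0r_neq0// modulus_gt0.
Qed.

End orbits.

(** * Average expansivity in terms of growth *)

Section characterization.
Context {R : realType} {s : scalar_kind} {A : kothe_matrix R} {p : R}.
Context {w : int -> scalar_field R s}.
Context {T : invertible_operator (kothe s A p)}.
Context (w_neq0 : forall j, w j != 0).
Context (TE : forall x : kothe s A p,
  kothe_fun (T x) = weighted_shift w (kothe_fun x)).
Local Notation v := (cumulative_weight w).
Local Notation seminorm := (@kothe_seminorm R s A p).

Lemma growth_ge0 k j : 0 <= growth A w k j.
Proof. by rewrite mulr_ge0 ?kothe_entry_nonneg ?invr_ge0 ?modulus_ge0. Qed.

Lemma growthN k j :
  growth A w k (- j.+1%:Z) =
  A (- j.+1%:Z) k * modulus (\prod_(0 <= i < j.+1) w (- i%:Z)).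
Proof.
rewrite /growth -NegzE /v modulusV ?invrK//.
by rewrite prodf_seq_neq0; apply/allP => i _; apply/implyP.
Qed.

(** The coordinate m of x travels to the place m - n under the n-th iterate;
    its contribution there bounds the seminorm from below. *)
Lemma growth_le_orbit x k m n :
  modulus (v m * kothe_fun x m) * growth A w k (m - n) <= seminorm k (op_iter T n x).
Proof.
apply: le_trans (coord_le_kothe_seminorm _ _ (m - n)).
by rewrite (modulus_op_iter w_neq0 TE) subrK /growth mulrCA.
Qed.

Lemma orbit_unit_vector_le k n :
  seminorm k (op_iter T n unit_vector) <= growth A w k (- n).
Proof.
apply: le_trans (kothe_seminorm_supported _ _ (- n) _) _ => [j jn|].
  have vj0 := cumulative_weight_neq0 _ w_neq0 j.
  apply: (mulfI vj0); rewrite (op_iter_transport w_neq0 TE)/= /unit_seq.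
  by rewrite addr_eq0 (negbTE jn) !mulr0.
rewrite (modulus_op_iter w_neq0 TE) addNr /= /unit_seq eqxx mulr1.
by rewrite /cumulative_weight/= big_geq// modulus1 mul1r.
Qed.

(** The unit vector decides one direction, as its orbit has the seminorms
    growth; any nonzero coordinate of x decides the other. *)
Lemma average_expansive_growth :
  average_expansive seminorm T <-> exists k,
    unbounded (fun n => n%:R^-1 * \sum_(1 <= j < n.+1) growth A w k (- j%:Z)) \/
    unbounded (fun n => n%:R^-1 * \sum_(1 <= j < n.+1) growth A w k j%:Z).
Proof.
split=> [Texp|[k kunb] x x0].
  have [k /ereal_sup_pinfty kunb] := Texp _ unit_vector_neq0.
  exists k; apply: contrapT => /not_orP[bddN bddP].
  have [M1 leM1] := not_unbounded _ bddN; have [M2 leM2] := not_unbounded _ bddP.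
  have [n n0] := kunb (growth A w k 0 + M1 + M2); apply/negP; rewrite -leNgt.
  have W0 : 0 < (2 * n + 1)%N%:R :> R by rewrite ltr0n addn1.
  have nR0 : 1 <= n%:R :> R by rewrite ler1n.
  rewrite ler_pdivrMl//.
  apply: (@le_trans _ _ (\sum_(i < 2 * n + 1) growth A w k (- (i%:Z - n%:Z)))).
    by apply: ler_sum => i _; exact: orbit_unit_vector_le.
  rewrite (sum_window (fun i => growth A w k (- i))) oppr0.
  under [X in _ + X + _]eq_bigr do rewrite opprK.
  have := leM1 _ n0; have := leM2 _ n0.
  rewrite !ler_pdivrMl ?(lt_le_trans ltr01)// natrD natrM.
  set SN := \sum_(_ <= _ < _) growth A w k (- _); set SP := \sum_(_ <= _ < _) _.
  (* As the sums are nonnegative, so are M1 and M2; this absorbs the difference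
     between n and 2 n + 1. *)
  have SN0 : 0 <= SN by apply: sumr_ge0 => j _; exact: growth_ge0.
  have SP0 : 0 <= SP by apply: sumr_ge0 => j _; exact: growth_ge0.
  have g0 := growth_ge0 k 0.
  nra.
have [m xm0] := kothe_neq0 _ x0.
exists k; apply/ereal_sup_pinfty => M.
pose c := modulus (v m * kothe_fun x m).
have c0 : 0 < c by rewrite modulus_gt0// mulf_neq0// cumulative_weight_neq0.
have [n n0 Mn] : exists2 n, (0 < n)%N & M < (2 * n + 1)%:R^-1 *
    \sum_(i < 2 * n + 1) (c * growth A w k (m - (i%:Z - n%:Z))).
  case: kunb => kunb.
  - apply: (unbounded_window_average _ m (fun j => - j%:Z)) kunb M => //.
    + exact: growth_ge0.
    + by move=> i j /oppr_inj[].
    + by move=> j; rewrite abszN.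
  - apply: (unbounded_window_average _ m Posz) kunb M => //.
    + exact: growth_ge0.
    + by move=> i j [].
exists n => //; apply: (lt_le_trans Mn); rewrite ler_wpM2l ?invr_ge0//.
by apply: ler_sum => i _; exact: growth_le_orbit.
Qed.

End characterization.

Theorem corollary5 (R : realType) (s : scalar_kind) (A : kothe_matrix R)
    (p : R) (hp : p = 0 \/ 1 <= p)
    (w : int -> scalar_field R s) (hw : forall j, w j != 0)
    (B_w : invertible_operator (kothe s A p))
    (hB_w : forall x : kothe s A p,
      kothe_fun (B_w x) = weighted_shift w (kothe_fun x)) :
  average_expansive (@kothe_seminorm R s A p) B_w <->
  exists k : nat,
    ereal_sup [set (n%:R^-1 * \sum_(1 <= j < n.+1)
        A (- j%:Z) k * modulus (\prod_(0 <= i < j) w (- i%:Z)))%:E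
      | n in [set n : nat | (0 < n)%N]] = +oo%E
    \/
    ereal_sup [set (n%:R^-1 * \sum_(1 <= j < n.+1)
        A j%:Z k / modulus (\prod_(1 <= i < j.+1) w i%:Z))%:E
      | n in [set n : nat | (0 < n)%N]] = +oo%E.
Proof.
rewrite (average_expansive_growth hw hB_w).
have negE k : (fun n : nat =>
    n%:R^-1 * \sum_(1 <= j < n.+1) growth A w k (- j%:Z)) =
    (fun n : nat => n%:R^-1 * \sum_(1 <= j < n.+1)
      A (- j%:Z) k * modulus (\prod_(0 <= i < j) w (- i%:Z))).
  apply/funext => n; congr (_ * _).
  by rewrite !big_add1; apply: eq_bigr => j _; exact: growthN.
by split=> -[k kunb]; exists k; move: kunb; rewrite !ereal_sup_pinfty negE.
Qed.
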